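(* Let $X,Y$ be nonempty compact convex sets in Euclidean spaces, and let $Z=X\times Y$ be equipped with a proximal setup (norm $\|\cdot\|$, distance-generating function $\omega$, Bregman distance $V$, prox-mapping $\mathrm{Prox}$, $\omega$-center $z_\omega$, set width $\Omega$). Let $T\ge1$ and, for $t\in[T]$, let $\phi_t:X\times Y\to\mathbb{R}$ be such that $\phi_t(x,y)$ is convex in $x$ and concave in $y$. For $z=[x;y]\in Z$ write $F_t(z)=[\nabla_x\phi_t(x,y);-\nabla_y\phi_t(x,y)]$, and suppose there exists $L\in(0,\infty)$ with $\|F_t(z)-F_t(v)\|_*\le L\|z-v\|$ for all $v,z\in Z$ and all $t\in[T]$. Let $\theta\in\Delta_T$. Set $v_1:=z_\omega$ and for $t=1,\dots,T$ let $$z_t=[x_t;y_t]:=\mathrm{Prox}_{v_t}(\gamma_t\theta_tF_t(v_t)),\qquad v_{t+1}:=\mathrm{Prox}_{v_t}(\gamma_t\theta_tF_t(z_t)),$$ with step sizes $\gamma_t=\frac{1}{L\sup_{s\in[T]}\theta_s}$ for all $t\in[T]$. Then $$\sup_{y\in Y}\sum_{t=1}^{T}\theta_t\phi_t(x_t,y)-\inf_{x\in X}\sum_{t=1}^{T}\theta_t\phi_t(x,y_t)\ \le\ \Omega L\sup_{t\in[T]}\theta_t.$$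
   Context: $[T]=\{1,\dots,T\}$; $\Delta_T=\{\theta\in\mathbb{R}^T_+:\sum_{t}\theta_t=1\}$; $[x;y]$ is the concatenation of $x$ and $y$. $\nabla_x\phi_t(x,y)$ denotes a (selected) subgradient at $x$ of the convex function $\phi_t(\cdot,y)$, and $\nabla_y\phi_t(x,y)$ a (selected) supergradient at $y$ of the concave function $\phi_t(x,\cdot)$ (gradients if differentiable). Proximal setup for a convex domain $Z$ in a Euclidean space $E$: (i) a norm $\|\cdot\|$ on $E$ with dual norm $\|\zeta\|_*=\max_{\|z\|\le 1}\langle\zeta,z\rangle$; (ii) a distance-generating function $\omega:Z\to\mathbb{R}$, convex and continuous on $Z$, admitting a selection of subgradients $\nabla\omega(z)$ that is continuous on $Z^\circ:=\{z\in Z:\partial\omega(z)\ne\emptyset\}$, and strongly convex with modulus 1: $\langle\nabla\omega(z')-\nabla\omega(z''),z'-z''\rangle\ge\|z'-z''\|^2$ for all $z',z''\in Z^\circ$; (iii) Bregman distance $V_z(z'):=\omega(z')-\omega(z)-\langle\nabla\omega(z),z'-z\rangle$ for $z\in Z^\circ$, $z'\in Z$; (iv) prox-mapping $\mathrm{Prox}_z(\xi):=\arg\min_{z'\in Z}\{\langle\xi,z'\rangle+V_z(z')\}$, a map $E\to Z^\circ$, for $z\in Z^\circ$; (v) $\omega$-center $z_\omega:=\arg\min_{z\in Z}\omega(z)$; (vi) set width $\Omega:=\max_{z\in Z}V_{z_\omega}(z)$. Existence of these minimizers and of the maximum is part of the setup. *)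

(* Defs.v *)
(* Euclidean spaces are the coordinate spaces of row vectors, with inner product
   dotp; the norm of the proximal setup is unrelated to it. *)
From mathcomp Require Import all_boot all_order all_algebra.
From mathcomp Require Import all_classical all_reals all_analysis.

Set Implicit Arguments.
Unset Strict Implicit.
Unset Printing Implicit Defensive.

Import Order.TTheory GRing.Theory Num.Theory.
Import numFieldNormedType.Exports.

Local Open Scope classical_set_scope.
Local Open Scope ring_scope.

Section Definitions.
Context {R : realType}.

Definition simplex (T : nat) : set ('I_T -> R) :=
  [set theta | (forall t, 0 <= theta t) /\ \sum_t theta t = 1].

Section EuclideanSpace.
Context {n : nat}.
Local Notation E := 'rV[R]_n.

Definition dotp (u v : E) : R := \sum_i u 0 i * v 0 i.

Definition is_norm (N : E -> R) : Prop :=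
  [/\ forall u v, N (u + v) <= N u + N v,
      forall (a : R) u, N (a *: u) = `|a| * N u
    & forall u, N u = 0 -> u = 0].

Definition dual_norm (N : E -> R) (zeta : E) : R :=
  sup [set dotp zeta z | z in [set z | N z <= 1]].

Definition concave_function (A : set E) (f : E -> R) : Prop :=
  convex_function A (fun x => - f x).

(* Relative to the domain A of f: the inequality is required on A only. *)
Definition subdifferential (A : set E) (f : E -> R) (x : E) : set E :=
  [set g | forall x', A x' -> f x + dotp g (x' - x) <= f x'].

Definition superdifferential (A : set E) (f : E -> R) (x : E) : set E :=
  [set g | forall x', A x' -> f x' <= f x + dotp g (x' - x)].

Definition is_argmin (A : set E) (f : E -> R) (w : E) : Prop :=
  A w /\ forall z, A z -> f w <= f z.

(* A minimizer, when there is one; 0 otherwise. In the proximal setup below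
   minimizers exist by assumption and are unique by strong convexity. *)
Definition argmin (A : set E) (f : E -> R) : E :=
  xget 0 [set w | is_argmin A f w].

Section Prox.
Variables (Z : set E) (omega : E -> R) (domega : E -> E).

Definition dgf_domain : set E :=
  [set z | Z z /\ subdifferential Z omega z !=set0].

Definition bregman (z z' : E) : R :=
  omega z' - omega z - dotp (domega z) (z' - z).

Definition prox_objective (z xi z' : E) : R := dotp xi z' + bregman z z'.

Definition prox (z xi : E) : E := argmin Z (prox_objective z xi).

Definition dgf_center : E := argmin Z omega.

Definition set_width : R := sup [set bregman dgf_center z | z in Z].

End Prox.

(* The functions omega and domega are total; only their values on Z and on
   dgf_domain Z omega, respectively, are constrained. *)
Record proximal_setup (Z : set E) (N : E -> R) (omega : E -> R)
    (domega : E -> E) : Prop := ProximalSetup {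
  setup_norm : is_norm N ;
  dgf_convex : convex_function Z omega ;
  dgf_continuous : {within Z, continuous omega} ;
  dgf_selection : forall z, dgf_domain Z omega z ->
    subdifferential Z omega z (domega z) ;
  dgf_selection_continuous : {within dgf_domain Z omega, continuous domega} ;
  dgf_strongly_convex : forall z' z'',
    dgf_domain Z omega z' -> dgf_domain Z omega z'' ->
    N (z' - z'') ^+ 2 <= dotp (domega z' - domega z'') (z' - z'') ;
  prox_exists : forall z xi, dgf_domain Z omega z ->
    exists w, is_argmin Z (prox_objective omega domega z xi) w ;
  prox_in_domain : forall z xi, dgf_domain Z omega z ->
    dgf_domain Z omega (prox Z omega domega z xi) ;
  center_exists : exists w, is_argmin Z omega w ;
  width_attained : exists2 zmax, Z zmax & forall z, Z z ->
    bregman omega domega (dgf_center Z omega) z <=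
    bregman omega domega (dgf_center Z omega) zmax
}.

End EuclideanSpace.

Section SaddlePoint.
Context {n m : nat}.

(* X x Y inside 'rV_(n + m): the concatenation [x; y] is row_mx x y. *)
Definition prod_set (X : set 'rV[R]_n) (Y : set 'rV[R]_m) :
    set 'rV[R]_(n + m) :=
  [set z | X (lsubmx z) /\ Y (rsubmx z)].

Definition saddle_field (gx : 'rV[R]_n -> 'rV[R]_m -> 'rV[R]_n)
    (gy : 'rV[R]_n -> 'rV[R]_m -> 'rV[R]_m) (z : 'rV[R]_(n + m)) :
    'rV[R]_(n + m) :=
  row_mx (gx (lsubmx z) (rsubmx z)) (- gy (lsubmx z) (rsubmx z)).

End SaddlePoint.

End Definitions.

(* Main.v *)
Require Import Defs.
From mathcomp Require Import all_boot all_order all_algebra.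
From mathcomp Require Import all_classical all_reals all_analysis.
From mathcomp Require Import ring lra.

Set Implicit Arguments.
Unset Strict Implicit.
Unset Printing Implicit Defensive.

Import Order.TTheory GRing.Theory Num.Theory.
Import numFieldNormedType.Exports.

Local Open Scope classical_set_scope.
Local Open Scope ring_scope.

(** One step of the method obeys the inequality
    dotp eta (w - u) <= V v u - V v' u for every u in Z, where xi and eta are
    the scaled fields used by the two prox-mappings, w is the leading point
    and v' the next centre. Adding the optimality conditions of the two
    prox-mappings gives this inequality up to the error
    dotp (eta - xi) (w - v') - V w v' - V v w; the Lipschitz condition and the
    step size bound the first term by N (w - v) * N (w - v'), and strong
    convexity makes each Bregman distance at least half a squared norm, so the
    error is nonpositive by the inequality of arithmetic and geometric means
    ([extragradient_step]). Every gamma t equals 1 / (L * sup theta), hence the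
    steps telescope to V v_1 u - V v_(T+1) u, which is at most the set width;
    and convexity-concavity bounds the gap at time t by the pairing with the
    field ([gap_le_saddle_field]).

    The delicate point is the use of the selected subgradient domega at points
    where omega need not be differentiable, in particular on the boundary of
    Z, and where the domain Z° of the subdifferential need not contain the
    segment between two of its points. Two facts rest on it: the optimality
    condition of the prox-mapping holds with the selected subgradient of
    omega, and V w u >= N (u - w) ^+ 2 / 2. Both follow from one
    approximation result ([subdifferential_approx]): minimizing omega plus a
    steep quadratic centred at p yields a point q of Z° as close to p as
    desired, so Z° is dense in Z.
    - Optimality ([selection_dominates]): if g is any subgradient at w, the
      selected one satisfies dotp g (u - w) <= dotp (domega w) (u - w) for u
      in Z. To see it, apply monotonicity between w and points of Z° that
      approach w tangentially to the direction u - w, and pass to the limit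
      with the continuity of domega.
    - Strong convexity ([bregman_strongly_convex]): a lower bound
      V w u >= c * N (u - w) ^+ 2 improves to c / 2 + 1 / 4 when the segment is
      cut near its midpoint ([bregman_lower_bound_step]); iterating from c = 0
      leads to 1 / 2. *)

(** * Inner product, sup norm and Lipschitz maps *)

Lemma lipschitz_continuous (R : realType) (V W : normedModType R) (f : V -> W)
    (C : R) :
  (forall x y, `|f x - f y| <= C * `|x - y|) -> continuous f.
Proof.
move=> fC x; apply/cvgrPdist_lt => e e0.
have C0 : 0 < `|C| + 1 by rewrite ltr_wpDl.
near=> y; rewrite (le_lt_trans (fC _ _))//.
rewrite (@le_lt_trans _ _ ((`|C| + 1) * `|x - y|))//.
  by rewrite ler_wpM2r// ler_wpDr// ler_norm.
rewrite mulrC -ltr_pdivlMr//; near: y.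
by apply: cvgr_dist_lt; [exact: cvg_id | rewrite divr_gt0].
Unshelve. all: by end_near. Qed.

Section InnerProduct.
Context {R : realType} {n : nat}.
Implicit Types u v w : 'rV[R]_n.

Lemma dotpDl u v w : dotp (u + v) w = dotp u w + dotp v w.
Proof.
by rewrite /dotp -big_split; apply: eq_bigr => i _; rewrite mxE mulrDl.
Qed.

Lemma dotpC u v : dotp u v = dotp v u.
Proof. by apply: eq_bigr => i _; rewrite mulrC. Qed.

Lemma dotpDr u v w : dotp u (v + w) = dotp u v + dotp u w.
Proof. by rewrite !(dotpC u) dotpDl. Qed.

Lemma dotpZl (a : R) u v : dotp (a *: u) v = a * dotp u v.
Proof.
by rewrite /dotp mulr_sumr; apply: eq_bigr => i _; rewrite mxE mulrA.
Qed.

Lemma dotpZr (a : R) u v : dotp u (a *: v) = a * dotp u v.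
Proof. by rewrite dotpC dotpZl dotpC. Qed.

Lemma dotpNl u v : dotp (- u) v = - dotp u v.
Proof. by rewrite -scaleN1r dotpZl mulN1r. Qed.

Lemma dotpNr u v : dotp u (- v) = - dotp u v.
Proof. by rewrite dotpC dotpNl dotpC. Qed.

Lemma dotp0r u : dotp u 0 = 0.
Proof. by rewrite -[0](scale0r 0) dotpZr mul0r. Qed.

Definition dotpE := (dotpDl, dotpDr, dotpNl, dotpNr, dotpZl, dotpZr).

Lemma coord_le_norm u i : `|u 0 i| <= `|u|.
Proof.
rewrite [leRHS]/Num.Def.normr/= mx_normrE.
exact: (le_bigmax _ (fun j : 'I_1 * 'I_n => `|u j.1 j.2|) (0, i)).
Qed.

Lemma dotp_le_norm u v : `|dotp u v| <= n%:R * (`|u| * `|v|).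
Proof.
rewrite (le_trans (ler_norm_sum _ _ _))//.
rewrite mulr_natl -[X in _ *+ X](card_ord n) -sumr_const ler_sum// => i _.
by rewrite normrM ler_pM// coord_le_norm.
Qed.

Lemma dotp_ge0 u : 0 <= dotp u u.
Proof. by rewrite sumr_ge0// => i _; rewrite -expr2 sqr_ge0. Qed.

Lemma sqr_norm_le_dotp u : `|u| ^+ 2 <= dotp u u.
Proof.
have [->|u0] := eqVneq `|u| 0; first by rewrite expr0n dotp_ge0.
have [[i j] /= Eu] := mx_norm_neq0 (u0 : mx_norm u != 0).
rewrite [`|u|]Eu (ord1 i) real_normK ?num_real// /dotp (bigD1 j)//= -expr2.
by rewrite lerDl sumr_ge0// => k _; rewrite -expr2 sqr_ge0.
Qed.

Lemma dotp_sqr_continuous u : continuous (fun v => dotp (v - u) (v - u)).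
Proof.
apply: (continuous_big (op := +%R)); first exact: add_continuous.
move=> i _ v.
suff cvi : continuous (fun w : 'rV[R]_n => (w - u) 0 i).
  exact: (cvgM (cvi v) (cvi v)).
apply: (@lipschitz_continuous _ _ _ _ 1) => x y; rewrite mul1r.
rewrite (_ : (x - u) 0 i - (y - u) 0 i = (x - y) 0 i) ?coord_le_norm//.
by rewrite !mxE; ring.
Qed.

End InnerProduct.

(** * Convexity and continuity in explicit form *)

Section Segments.
Context {R : realType}.

(** Packages the final choice of a small parameter in the limiting arguments
    below, so that no limit has to be formed. *)
Lemma small_step (a b c d : R) : 0 < b -> 0 < d ->
  exists s, [/\ 0 < s, s <= 1, s * a < b & s * c < d].
Proof.
move=> b0 d0.
pose s := Num.min 1 (Num.min (b / (`|a| + 1)) (d / (`|c| + 1))).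
have na : 0 < `|a| + 1 by rewrite ltr_wpDl.
have nc : 0 < `|c| + 1 by rewrite ltr_wpDl.
have s0 : 0 < s by rewrite !lt_min ltr01 !divr_gt0.
have lesa : s * (`|a| + 1) <= b.
  by rewrite -ler_pdivlMr// /s !ge_min lexx orbT.
have lesc : s * (`|c| + 1) <= d.
  by rewrite -ler_pdivlMr// /s !ge_min lexx !orbT.
exists s; split=> //; first by rewrite /s ge_min lexx.
- by apply: lt_le_trans lesa; rewrite ltr_pM2l// ltr_pwDr// ler_norm.
- by apply: lt_le_trans lesc; rewrite ltr_pM2l// ltr_pwDr// ler_norm.
Qed.

Context {n : nat}.

Lemma segment_conv x y (s : R) (s0 : 0 <= s) (s1 : s <= 1) :
  x + s *: (y - x) =
  conv (Itv01 s0 s1) (y : convex_lmodType 'rV[R]_n)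
    (x : convex_lmodType 'rV[R]_n).
Proof.
by rewrite /conv/= scalerBl scale1r scalerBr addrCA.
Qed.

Lemma convex_set_segment (A : set 'rV[R]_n) x y (s : R) : convex_set A ->
  A x -> A y -> 0 <= s <= 1 -> A (x + s *: (y - x)).
Proof.
move=> cA /mem_set Ax /mem_set Ay /andP[s0 s1].
by rewrite segment_conv; apply/set_mem/cA.
Qed.

Lemma convex_function_segment (A : set 'rV[R]_n) (f : 'rV[R]_n -> R) x y s :
  convex_function A f -> A x -> A y -> 0 <= s <= 1 ->
  f (x + s *: (y - x)) <= f x + s * (f y - f x).
Proof.
move=> cf /mem_set Ax /mem_set Ay /andP[s0 s1].
rewrite segment_conv; apply: le_trans (cf (Itv01 s0 s1) y x Ay Ax) _.
rewrite convRE /= /unstable.onem; lra.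
Qed.

Lemma within_continuous_ball (A : set 'rV[R]_n) m (f : 'rV[R]_n -> 'rV[R]_m)
    x e :
  {within A, continuous f} -> A x -> 0 < e ->
  exists2 d, 0 < d & forall y, A y -> `|y - x| < d -> `|f y - f x| < e.
Proof.
move=> /subspace_continuousP/(_ x) + Ax e0 => /(_ Ax)/cvgrPdist_lt/(_ e e0).
rewrite near_withinE => /nbhs_ballP[d /= d0 sub]; exists d => // y Ay yx.
by rewrite distrC; apply: sub => //; rewrite -ball_normE /= distrC.
Qed.

End Segments.

(** * Subgradients and the optimality condition of the prox-mapping *)

Section Subgradients.
Context {R : realType} {n : nat}.
Implicit Types (Z : set 'rV[R]_n) (omega : 'rV[R]_n -> R).

(** The point q minimizes omega x + l / 2 * dotp (x - p) (x - p) over x in Z,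
    which is compact. Comparing it with p itself shows that q tends to p as l
    grows, and its optimality along segments shows that l *: (p - q) is a
    subgradient of omega at q. That subgradient points from q towards p, whence
    the last clause: it allows [dgf_domain_approx] to control the subgradient
    in the direction p - q, although subgradients may blow up near the
    boundary. *)
Lemma subdifferential_approx Z omega p d :
  compact Z -> convex_set Z -> convex_function Z omega ->
  {within Z, continuous omega} -> Z p -> 0 < d ->
  exists q g, [/\ Z q, `|q - p| < d, subdifferential Z omega q g
                & 0 <= dotp g (p - q)].
Proof.
move=> Zcomp Zconv oconv ocont Zp d0.
have Z0 : Z !=set0 by exists p.
have [m _ mmin] := EVT_min_rV Z0 Zcomp ocont.
have mp : omega m <= omega p by apply: mmin; exact: mem_set.
(* This l makes the penalty at distance d exceed the oscillation of omega. *)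
pose l := 2 * (omega p - omega m) / d ^+ 2 + 1.
have d20 : 0 < d ^+ 2 by rewrite exprn_gt0.
have l0 : 0 < l.
  by rewrite ltr_wpDl// divr_ge0 ?(ltW d20)// mulr_ge0// subr_ge0.
pose f q := omega q + l / 2 * dotp (q - p) (q - p).
have fcont : {within Z, continuous f}.
  apply/subspace_continuousP => x Zx.
  apply: cvgD; first by move/subspace_continuousP : ocont; exact.
  apply: cvgM; first exact: cvg_cst.
  move/subspace_continuousP :
    (continuous_subspaceT (A := Z) (@dotp_sqr_continuous R n p)).
  exact.
have [q /set_mem Zq qmin] := EVT_min_rV Z0 Zcomp fcont.
have fq u : Z u -> f q <= f u by move=> /mem_set; exact: qmin.
exists q, (l *: (p - q)); split=> //.
- rewrite -(ltr_pXn2r (n := 2)) ?nnegrE ?normr_ge0 ?(ltW d0)//.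
  apply: le_lt_trans (sqr_norm_le_dotp _) _.
  have := fq _ Zp; rewrite /f subrr dotp0r mulr0 addr0 => h.
  have := mmin _ (mem_set Zq) => h2.
  rewrite -(ltr_pM2l l0).
  have -> : l * d ^+ 2 = 2 * (omega p - omega m) + d ^+ 2.
    by rewrite /l; field; rewrite gt_eqF.
  lra.
- move=> u Zu.
  apply/ler_addgt0Pr => e e0.
  (* Minimality at q + s (u - q), divided by s, gives the subgradient
     inequality up to an error of order s. *)
  have [s [s0 s1 sb _]] :=
    @small_step R (l / 2 * dotp (u - q) (u - q)) e 0 1 e0 ltr01.
  have s01 : 0 <= s <= 1 by rewrite ltW.
  have := fq _ (convex_set_segment Zconv Zq Zu s01).
  have := convex_function_segment oconv Zq Zu s01.
  rewrite /f.
  have -> : q + s *: (u - q) - p = (q - p) + s *: (u - q) by rewrite addrAC.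
  rewrite (dotpDl (q - p)) !(dotpDr _ (q - p)) !dotpZl !dotpZr.
  rewrite (dotpC (u - q) (q - p)) -(opprB q p) dotpNl.
  set a := dotp (q - p) (u - q); set b := dotp (u - q) (u - q) in sb *.
  set c := dotp (q - p) (q - p) => h1 h2.
  rewrite -subr_ge0 -(pmulr_rge0 _ s0).
  have : s * (s * (l / 2 * b)) <= s * e by rewrite ler_pM2l// ltW.
  nra.
- by rewrite dotpZl mulr_ge0 ?dotp_ge0 ?ltW.
Qed.

Lemma subdifferential_monotone Z omega u v g h : Z u -> Z v ->
  subdifferential Z omega u g -> subdifferential Z omega v h ->
  0 <= dotp (g - h) (u - v).
Proof.
move=> Zu Zv /(_ _ Zv) + /(_ _ Zu).
by rewrite -(opprB u v) !dotpE; lra.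
Qed.

End Subgradients.

Section Setup.
Context {R : realType} {n : nat}.
Context {Z : set 'rV[R]_n} {N omega : 'rV[R]_n -> R}.
Context {domega : 'rV[R]_n -> 'rV[R]_n}.
Context (setup : proximal_setup Z N omega domega).
Context (Zcompact : compact Z) (Zconvex : convex_set Z).
Local Notation Zo := (dgf_domain Z omega).
Local Notation V := (bregman omega domega).

(** The point w minimizes omega - dotp g over Z. At a point q of Z° near
    w + s (u - w), monotonicity gives 0 <= dotp (domega q - g) (q - w), and
    q - w is s *: (u - w) up to an error r smaller than s ^+ 2, so that r is
    still negligible after division by s. The limit s -> 0 replaces domega q by
    domega w. *)
Lemma selection_dominates w g u : Zo w -> subdifferential Z omega w g -> Z u ->
  dotp g (u - w) <= dotp (domega w) (u - w).
Proof.
move=> Zow wg Zu; have Zw := Zow.1.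
apply/ler_addgt0Pr => e e0.
set k : R := n%:R; have k0 : 0 <= k by exact: ler0n.
(* e1 is the accuracy asked of domega near w, s the position on the segment. *)
have [e1 [e10 _ e1e _]] :=
  @small_step R (k * `|u - w|) (e / 2) 0 1 (divr_gt0 e0 (ltr0Sn R 1)) ltr01.
have [d d0 cont] :=
  within_continuous_ball (dgf_selection_continuous setup) Zow e10.
have [s [s0 s1 sd se]] := @small_step R (`|u - w| + 1) d
  (k * (`|domega w - g| + e1)) (e / 2) d0 (divr_gt0 e0 (ltr0Sn R 1)).
have s01 : 0 <= s <= 1 by rewrite ltW.
have [q [h [Zq qp qh _]]] := subdifferential_approx Zcompact Zconvex
  (dgf_convex setup) (dgf_continuous setup)
  (convex_set_segment Zconvex Zw Zu s01) (mulr_gt0 s0 s0).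
set r := q - _ in qp.
have qw : q - w = s *: (u - w) + r.
  by apply/rowP => i; rewrite !mxE; ring.
have Zoq : Zo q by split=> //; exists h.
have qwd : `|q - w| < d.
  rewrite qw; apply: le_lt_trans (ler_normD _ _) (le_lt_trans _ sd).
  rewrite normrZ gtr0_norm// mulrDr mulr1 lerD2l (le_trans (ltW qp))//.
  by rewrite ler_piMr// ltW.
have := subdifferential_monotone Zq Zw (dgf_selection setup Zoq) wg.
have {}cont := cont _ Zoq qwd.
have b1 : dotp (domega q - domega w) (u - w) <= e / 2.
  apply: le_trans (ler_norm _) (le_trans (dotp_le_norm _ _) _).
  apply: le_trans (ltW e1e).
  by rewrite mulrCA ler_wpM2r ?mulr_ge0// ltW.
have b2 : dotp (domega q - g) r <= s * (e / 2).
  apply: le_trans (ler_norm _) (le_trans (dotp_le_norm _ _) _).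
  apply: (@le_trans _ _ (s * (s * (k * (`|domega w - g| + e1))))).
    have : `|domega q - g| <= `|domega w - g| + e1.
      rewrite -(subrK (domega w) (domega q)) -addrA addrC.
      by apply: le_trans (ler_normD _ _) _; rewrite lerD2l ltW.
    move=> hq.
    have := ler_pM (normr_ge0 _) (normr_ge0 _) hq (ltW qp).
    by move=> /(ler_wpM2l k0); rewrite -/k; lra.
  by rewrite ler_pM2l// ltW.
rewrite qw (dotpDr _ (s *: _)) dotpZr => h1.
have : 0 <= s * (dotp (domega q - g) (u - w) + e / 2) by lra.
rewrite pmulr_rge0//.
have -> : dotp (domega q - g) (u - w) =
    dotp (domega q - domega w) (u - w) + dotp (domega w) (u - w)
    - dotp g (u - w).
  by rewrite !(dotpDl, dotpNl); lra.
lra.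
Qed.

(** Density of Z°, together with a sign for the selected subgradient at q in
    the direction of p. The sign replaces a bound on domega q, which need not
    exist as q approaches p. *)
Lemma dgf_domain_approx p d : Z p -> 0 < d ->
  exists q, [/\ Zo q, `|q - p| < d & 0 <= dotp (domega q) (p - q)].
Proof.
move=> Zp d0.
have [q [g [Zq qp qg g0]]] := subdifferential_approx Zcompact Zconvex
  (dgf_convex setup) (dgf_continuous setup) Zp d0.
have Zoq : Zo q by split=> //; exists g.
exists q; split=> //.
exact: le_trans g0 (selection_dominates Zoq qg Zp).
Qed.

Lemma bregman_ge0 w u : Zo w -> Z u -> 0 <= V w u.
Proof.
move=> Zow Zu; have := dgf_selection setup Zow Zu.
by rewrite /bregman; lra.
Qed.

(** The optimality condition dotp (xi + domega w - domega v) (u - w) >= 0,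
    rewritten with the three-point identity. It comes from
    [selection_dominates]: minimality of w makes domega v - xi a subgradient
    of omega at w. *)
Lemma prox_optimal v xi w u : Zo v -> w = prox Z omega domega v xi -> Z u ->
  dotp xi (w - u) <= V v u - V w u - V v w.
Proof.
move=> Zov defw Zu.
have Zow : Zo w by rewrite defw; exact: (prox_in_domain setup).
have [_ wmin] : is_argmin Z (prox_objective omega domega v xi) w.
  by rewrite defw; exact: (xgetPex _ (prox_exists setup xi Zov)).
have : subdifferential Z omega w (domega v - xi).
  move=> u' Zu'; have := wmin _ Zu'.
  by rewrite /prox_objective /bregman !dotpE; lra.
move=> /(selection_dominates Zow)/(_ Zu).
by rewrite /bregman !dotpE; lra.
Qed.

Lemma dgf_center_domain : Zo (dgf_center Z omega).
Proof.
have [Zc cmin] : is_argmin Z omega (dgf_center Z omega).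
  exact: (xgetPex _ (center_exists setup)).
split=> //; exists 0 => u Zu.
by rewrite dotpC dotp0r addr0 cmin.
Qed.

Lemma bregman_le_width u : Z u ->
  V (dgf_center Z omega) u <= set_width Z omega domega.
Proof.
move=> Zu; have [zm _ zmax] := width_attained setup.
apply: ub_le_sup; last by exists u.
by exists (V (dgf_center Z omega) zm) => _ [v Zv <-]; exact: zmax.
Qed.

End Setup.

(** * Norms and their duals *)

Section Norm.
Context {R : realType} {n : nat} {N : 'rV[R]_n -> R} (normN : is_norm N).

Lemma is_normD u v : N (u + v) <= N u + N v.
Proof. by case: normN. Qed.

Lemma is_normZ (a : R) u : N (a *: u) = `|a| * N u.
Proof. by case: normN. Qed.

Lemma is_norm0 : N 0 = 0.
Proof. by rewrite -[0](scale0r 0) is_normZ normr0 mul0r. Qed.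

Lemma is_normN u : N (- u) = N u.
Proof. by rewrite -scaleN1r is_normZ normrN1 mul1r. Qed.

Lemma is_norm_ge0 u : 0 <= N u.
Proof. by have := is_normD u (- u); rewrite subrr is_norm0 is_normN; lra. Qed.

Lemma is_norm_gt0 u : u != 0 -> 0 < N u.
Proof.
move=> /eqP u0; rewrite lt_neqAle is_norm_ge0 andbT eq_sym; apply/eqP => h.
by case: normN => _ _ /(_ _ h).
Qed.

Lemma is_norm_le_sup_norm : exists C : R, forall u, N u <= C * `|u|.
Proof.
exists (\sum_(i < n) N (delta_mx 0 i)) => u.
rewrite {1}(row_sum_delta u).
apply: (@le_trans _ _ (\sum_(i < n) N (u 0 i *: delta_mx 0 i))).
  elim/big_ind2 : _ => [|a x b y ax bY|//]; first by rewrite is_norm0.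
  exact: le_trans (is_normD _ _) (lerD ax bY).
rewrite mulr_suml ler_sum// => i _.
by rewrite is_normZ mulrC ler_wpM2l ?is_norm_ge0 ?coord_le_norm.
Qed.

Lemma is_norm_continuous : continuous (N : 'rV[R]_n -> R).
Proof.
have [C NC] := is_norm_le_sup_norm.
apply: (@lipschitz_continuous _ _ _ _ C) => u v.
apply: le_trans (NC _); rewrite ler_norml.
have := is_normD (u - v) v; have := is_normD (v - u) u.
by rewrite !subrK -(opprB u v) is_normN => h1 h2; apply/andP; split; lra.
Qed.

(** The minimum of N over the unit sphere of the sup norm is positive. This
    makes the unit ball of N bounded, hence the supremum that defines the dual
    norm a genuine one. *)
Lemma sup_norm_le_is_norm : exists2 c : R, 0 < c & forall u, c * `|u| <= N u.
Proof.
pose S := [set u : 'rV[R]_n | `|u| = 1].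
have unitS u : u != 0 -> S (`|u|^-1 *: u).
  by move=> u0; rewrite /S/= normrZ normfV normr_id mulVf// normr_eq0.
have [S0|] := pselect (S !=set0); last first.
  move=> S0; exists 1 => // u; have [->|u0] := eqVneq u 0.
    by rewrite normr0 mulr0 is_norm0.
  by case: S0; exists (`|u|^-1 *: u); exact: unitS.
have Scompact : compact S.
  apply: bounded_closed_compact.
    by exists 1; split=> // x x1 u /= ->; exact: ltW.
  rewrite (_ : S = (fun u : 'rV[R]_n => `|u|) @^-1` [set 1])//.
  by apply: closed_comp => [x _|]; [exact: norm_continuous|exact: closed_eq].
have [u0 /set_mem Su0 umin] :=
  EVT_min_rV S0 Scompact (continuous_subspaceT is_norm_continuous).
have u0N : u0 != 0.
  apply/eqP => u00; move: Su0; rewrite /S u00/= normr0 => /eqP.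
  by rewrite eq_sym oner_eq0.
exists (N u0) => [|u]; first exact: is_norm_gt0.
have [->|uN] := eqVneq u 0; first by rewrite normr0 mulr0 is_norm0.
have := umin _ (mem_set (unitS _ uN)).
by rewrite is_normZ normfV normr_id ler_pdivlMl ?normr_gt0// mulrC.
Qed.

Lemma dotp_le_dual zeta u : dotp zeta u <= dual_norm N zeta * N u.
Proof.
have [->|u0] := eqVneq u 0; first by rewrite dotp0r is_norm0 mulr0.
have Nu := is_norm_gt0 u0.
have [c c0 cN] := sup_norm_le_is_norm.
rewrite -ler_pdivrMr// mulrC -dotpZr.
apply: ub_le_sup; last first.
  exists ((N u)^-1 *: u) => //=.
  by rewrite is_normZ gtr0_norm ?invr_gt0// mulVf// gt_eqF.
exists (n%:R * (`|zeta| * c^-1)) => _ [z /= z1 <-].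
apply: le_trans (ler_norm _) (le_trans (dotp_le_norm _ _) _).
rewrite ler_wpM2l ?ler0n// ler_wpM2l//.
by rewrite -[leRHS]mulr1 ler_pdivlMl// (le_trans (cN z)).
Qed.

End Norm.

(** * Strong convexity of the Bregman distance and the extragradient step *)

Section StrongConvexity.
Context {R : realType} {n : nat}.
Context {Z : set 'rV[R]_n} {N omega : 'rV[R]_n -> R}.
Context {domega : 'rV[R]_n -> 'rV[R]_n}.
Context (setup : proximal_setup Z N omega domega).
Context (Zcompact : compact Z) (Zconvex : convex_set Z).
Local Notation Zo := (dgf_domain Z omega).
Local Notation V := (bregman omega domega).
Local Notation normN := (setup_norm setup).

Lemma sqr_ge_of_sub_le (a b x : R) : 0 <= a -> 0 <= b -> 0 <= x -> a - b <= x ->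
  a ^+ 2 - 2 * (a * b) <= x ^+ 2.
Proof.
move=> a0 b0 x0 abx; have [ab|/ltW ba] := leP b a; last by nra.
have : 0 <= a - b by lra.
by nra.
Qed.

(** If q were the midpoint m of w and u, the identity
    V w u = V w q + V q u + dotp (domega q - domega w) (u - q) would give the
    constant c / 4 + c / 4 + 1 / 4, since u - m = m - w. As m may lie outside
    Z°, q is only close to m; the resulting term - 2 dotp (domega q) (q - m) is
    nonnegative by [dgf_domain_approx], and the other errors are at most a
    multiple of d. *)
Lemma bregman_lower_bound_step (c : R) : 0 <= c ->
  (forall w u, Zo w -> Z u -> c * N (u - w) ^+ 2 <= V w u) ->
  forall w u, Zo w -> Z u -> (c / 2 + 1 / 4) * N (u - w) ^+ 2 <= V w u.
Proof.
move=> c0 IH w u Zow Zu; have Zw := Zow.1.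
have [C NC] := is_norm_le_sup_norm normN.
set D := N (u - w); have D0 : 0 <= D := is_norm_ge0 normN _.
apply/ler_addgt0Pr => e e0.
have [d [d0 _ de _]] := @small_step R
  ((2 * c + 1) * (D * `|C|) + 2 * (n%:R * `|domega w|)) e 0 1 e0 ltr01.
have h01 : 0 <= (2^-1 : R) <= 1 by lra.
have [q [Zoq]] := dgf_domain_approx setup Zcompact Zconvex
  (convex_set_segment Zconvex Zw Zu h01) d0.
set m := w + _ => qm qopt.
have uq : u - q = (q - w) - 2 *: (q - m).
  by apply/rowP => i; rewrite /m !mxE; field.
have Nr : N (q - m) <= `|C| * d.
  apply: le_trans (NC _) (le_trans (ler_norm _) _).
  by rewrite normrM normr_id ler_wpM2l// ltW.
have Nm : N (m - w) = D / 2.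
  rewrite (_ : m - w = 2^-1 *: (u - w)); last by rewrite /m addrAC subrr add0r.
  by rewrite (is_normZ normN) gtr0_norm ?invr_gt0// mulrC.
have Nqw : D / 2 - `|C| * d <= N (q - w).
  have := is_normD normN (q - w) (- (q - m)).
  rewrite (is_normN normN) (_ : q - w - (q - m) = m - w) ?Nm; last first.
    by rewrite opprB addrC subrKA.
  lra.
have Nuq : D / 2 - `|C| * d <= N (u - q).
  have := is_normD normN (u - q) (q - m).
  rewrite (_ : u - q + (q - m) = m - w) ?Nm; first lra.
  by rewrite uq; apply/rowP => i; rewrite !mxE; ring.
have D20 : 0 <= D / 2 by rewrite divr_ge0.
have Cd0 : 0 <= `|C| * d by rewrite mulr_ge0// ltW.
have sqw := sqr_ge_of_sub_le D20 Cd0 (is_norm_ge0 normN _) Nqw.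
have suq := sqr_ge_of_sub_le D20 Cd0 (is_norm_ge0 normN _) Nuq.
have mono := dgf_strongly_convex setup Zoq Zow.
have Vwq := IH _ _ Zow Zoq.1.
have Vqu := IH _ _ Zoq Zu.
have three : V w u = V w q + V q u + dotp (domega q - domega w) (u - q).
  by rewrite /bregman !dotpE; lra.
have cross : dotp (domega q - domega w) (u - q) =
    dotp (domega q - domega w) (q - w) + 2 * dotp (domega q) (m - q)
    + 2 * dotp (domega w) (q - m).
  by rewrite uq !dotpE; lra.
have small : - (n%:R * `|domega w| * d) <= dotp (domega w) (q - m).
  have := dotp_le_norm (domega w) (q - m); rewrite ler_norml => /andP[+ _].
  apply: le_trans; rewrite lerN2 mulrA ler_wpM2l ?mulr_ge0 ?ler0n//.
  exact: ltW.
have csqw := ler_wpM2l c0 sqw; have csuq := ler_wpM2l c0 suq.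
rewrite three cross; lra.
Qed.

(** The strong monotonicity of domega in integrated form. After k
    improvements from c = 0 the constant is 1/2 - 1/2^(k+1). *)
Lemma bregman_strongly_convex w u : Zo w -> Z u ->
  2^-1 * N (u - w) ^+ 2 <= V w u.
Proof.
move=> Zow Zu.
have lower k : (2^-1 - 2^-1 ^+ k.+1) * N (u - w) ^+ 2 <= V w u.
  elim: k w u Zow Zu => [|k IH] w' u' Zow' Zu'.
    by rewrite expr1 subrr mul0r (bregman_ge0 setup).
  rewrite (_ : _ - _ = (2^-1 - 2^-1 ^+ k.+1) / 2 + 1 / 4); last first.
    by rewrite [_ ^+ k.+2]exprS; field.
  apply: bregman_lower_bound_step => //.
  rewrite subr_ge0 exprS ler_piMr// exprn_ile1//; lra.
apply/ler_addgt0Pr => e e0; set D := N (u - w) ^+ 2 in lower *.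
have De : D / e < 2 ^+ Num.bound (D / e) by exact: upper_nthrootP.
set k := Num.bound _ in De; have := lower k.
have : 2^-1 ^+ k.+1 * D <= e.
  rewrite exprVn -ler_pdivlMl ?invr_gt0 ?exprn_gt0// invrK.
  rewrite mulrC -ler_pdivrMl// mulrC (le_trans (ltW De))//.
  by rewrite exprS ler_peMl ?exprn_ge0// ler1n.
by lra.
Qed.

(** The leading point w is optimal for xi and is tested against v'; the next
    centre v' is optimal for eta and is tested against u. In the sum, V v v'
    cancels and what remains besides the claim is
    dotp (eta - xi) (w - v') - V w v' - V v w, which is nonpositive. *)
Lemma extragradient_step v xi eta w v' u :
  Zo v -> Z u ->
  w = prox Z omega domega v xi -> v' = prox Z omega domega v eta ->
  (forall h, dotp (eta - xi) h <= N (w - v) * N h) ->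
  dotp eta (w - u) <= V v u - V v' u.
Proof.
move=> Zov Zu defw defv' lip.
have Zow : Zo w by rewrite defw; exact: (prox_in_domain setup).
have Zov' : Zo v' by rewrite defv'; exact: (prox_in_domain setup).
have opt1 := prox_optimal setup Zcompact Zconvex Zov defw Zov'.1.
have opt2 := prox_optimal setup Zcompact Zconvex Zov defv' Zu.
have sc1 := bregman_strongly_convex Zov Zow.1.
have sc2 := bregman_strongly_convex Zow Zov'.1.
have := lip (w - v').
rewrite -(opprB w v') (is_normN normN) in sc2.
set a := N (w - v) in sc1 *; set b := N (w - v') in sc2 * => h.
have : a * b <= 2^-1 * a ^+ 2 + 2^-1 * b ^+ 2.
  by have := sqr_ge0 (a - b); nra.
move: h opt1 opt2; rewrite !dotpE; lra.
Qed.

End StrongConvexity.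

(** * Products and saddle functions *)

Section Product.
Context {R : realType} {n m : nat}.
Implicit Types (X : set 'rV[R]_n) (Y : set 'rV[R]_m).

Lemma row_mx_norm_le (x : 'rV[R]_n) (y : 'rV[R]_m) :
  `|row_mx x y| <= Num.max `|x| `|y|.
Proof.
rewrite [leLHS]/Num.Def.normr/= mx_normrE; apply: bigmax_le => [|[i j] _ /=].
  by rewrite le_max normr_ge0.
rewrite (ord1 i) mxE le_max.
by case: fintype.splitP => k _; rewrite coord_le_norm ?orbT.
Qed.

Lemma prod_set_compact X Y : compact X -> compact Y -> compact (prod_set X Y).
Proof.
move=> cX cY.
have -> : prod_set X Y =
    (fun p : 'rV[R]_n * 'rV[R]_m => row_mx p.1 p.2) @` (X `*` Y).
  apply/seteqP; split=> [z [Xz Yz]|_ [[x y] /= [Xx Yy] <-]].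
    by exists (lsubmx z, rsubmx z) => //=; rewrite hsubmxK.
  by rewrite /prod_set/= row_mxKl row_mxKr.
apply: continuous_compact; last exact: compact_setX.
apply: continuous_subspaceT; apply: (@lipschitz_continuous _ _ _ _ 1) => p q.
by rewrite mul1r opp_row_mx add_row_mx row_mx_norm_le.
Qed.

Lemma prod_set_convex X Y : convex_set X -> convex_set Y ->
  convex_set (prod_set X Y).
Proof.
move=> cX cY z1 z2 l /set_mem[Xz1 Yz1] /set_mem[Xz2 Yz2]; apply/mem_set; split.
- have := cX _ _ l (mem_set Xz1) (mem_set Xz2); rewrite inE.
  by rewrite /conv/= linearD !linearZ.
- have := cY _ _ l (mem_set Yz1) (mem_set Yz2); rewrite inE.
  by rewrite /conv/= linearD !linearZ.
Qed.

Lemma dotp_row_mx (x x' : 'rV[R]_n) (y y' : 'rV[R]_m) :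
  dotp (row_mx x y) (row_mx x' y') = dotp x x' + dotp y y'.
Proof.
rewrite /dotp big_split_ord; congr (_ + _); apply: eq_bigr => i _.
  by rewrite !row_mxEl.
by rewrite !row_mxEr.
Qed.

End Product.

Section Saddle.
Context {R : realType} {n m : nat}.

Lemma gap_le_saddle_field (X : set 'rV[R]_n) (Y : set 'rV[R]_m)
    (f : 'rV[R]_n -> 'rV[R]_m -> R) gx gy x y x' y' :
  X x' -> Y y' ->
  subdifferential X (f^~ y) x (gx x y) ->
  superdifferential Y (f x) y (gy x y) ->
  f x y' - f x' y <=
    dotp (saddle_field gx gy (row_mx x y)) (row_mx x y - row_mx x' y').
Proof.
move=> Xx' Yy' /(_ _ Xx') hx /(_ _ Yy') hy.
rewrite /saddle_field row_mxKl row_mxKr opp_row_mx add_row_mx dotp_row_mx.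
by move: hx hy; rewrite !dotpE; lra.
Qed.

Lemma ereal_sup_sub_inf_le (A B : Type) (P : set A) (Q : set B)
    (f : A -> R) (g : B -> R) (c : R) : P !=set0 -> Q !=set0 ->
  (forall a b, P a -> Q b -> f a - g b <= c) ->
  (ereal_sup [set (f a)%:E | a in P] - ereal_inf [set (g b)%:E | b in Q]
   <= c%:E)%E.
Proof.
move=> [a0 Pa0] [b0 Qb0] fg.
have lbg a : P a -> ((f a - c)%:E <= ereal_inf [set (g b)%:E | b in Q])%E.
  move=> Pa; apply: le_ereal_inf_tmp => _ [b Qb <-].
  by rewrite lee_fin; have := fg _ _ Pa Qb; lra.
(* An infinite infimum would spoil the rearrangement of the difference. *)
have gfin : ereal_inf [set (g b)%:E | b in Q] \is a fin_num.
  rewrite fin_numElt (lt_le_trans (ltNyr _) (lbg _ Pa0))/=.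
  by apply: le_lt_trans (ltry (g b0)); apply: ereal_inf_lbound; exists b0.
rewrite leeBlDr//; apply: ge_ereal_sup => _ [a Pa <-].
by rewrite -leeBlDl// -EFinB lbg.
Qed.

Lemma simplex_le_sup T (theta : 'I_T -> R) t : simplex theta ->
  theta t <= sup (range theta).
Proof.
move=> [theta0 theta1]; apply: ub_le_sup; last by exists t.
exists 1 => _ [s _ <-]; rewrite -theta1 (bigD1 s)//= lerDl sumr_ge0// => i _.
Qed.

Lemma simplex_sup_gt0 T (theta : 'I_T -> R) : simplex theta ->
  0 < sup (range theta).
Proof.
move=> thetaP; have [theta0 theta1] := thetaP.
rewrite ltNge; apply/negP => S0.
suff : \sum_t theta t <= 0 by rewrite theta1 ler10.
by apply: sumr_le0 => t _; exact: le_trans (simplex_le_sup t thetaP) S0.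
Qed.

End Saddle.

Theorem theorem5 (R : realType) (n m : nat)
    (X : set 'rV[R]_n) (Y : set 'rV[R]_m)
    (X0 : X !=set0) (Xcompact : compact X) (Xconvex : convex_set X)
    (Y0 : Y !=set0) (Ycompact : compact Y) (Yconvex : convex_set Y)
    (Z : set 'rV[R]_(n + m)) (defZ : Z = prod_set X Y)
    (N : 'rV[R]_(n + m) -> R) (omega : 'rV[R]_(n + m) -> R)
    (domega : 'rV[R]_(n + m) -> 'rV[R]_(n + m))
    (setup : proximal_setup Z N omega domega)
    (T : nat) (T_ge1 : (1 <= T)%N)
    (phi : 'I_T -> 'rV[R]_n -> 'rV[R]_m -> R)
    (phi_convex : forall t y, Y y -> convex_function X (fun x => phi t x y))
    (phi_concave : forall t x, X x -> concave_function Y (phi t x))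
    (gradx : 'I_T -> 'rV[R]_n -> 'rV[R]_m -> 'rV[R]_n)
    (grady : 'I_T -> 'rV[R]_n -> 'rV[R]_m -> 'rV[R]_m)
    (gradxP : forall t x y, X x -> Y y ->
       subdifferential X (fun x' => phi t x' y) x (gradx t x y))
    (gradyP : forall t x y, X x -> Y y ->
       superdifferential Y (phi t x) y (grady t x y))
    (F : 'I_T -> 'rV[R]_(n + m) -> 'rV[R]_(n + m))
    (defF : forall t, F t = saddle_field (gradx t) (grady t))
    (L : R) (L_gt0 : 0 < L)
    (F_lipschitz : forall t z v, Z z -> Z v ->
       dual_norm N (F t z - F t v) <= L * N (z - v))
    (theta : 'I_T -> R) (theta_simplex : simplex theta)
    (gamma : 'I_T -> R)
    (defgamma : forall t, gamma t = 1 / (L * sup (range theta)))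
    (v : nat -> 'rV[R]_(n + m)) (z : 'I_T -> 'rV[R]_(n + m))
    (x : 'I_T -> 'rV[R]_n) (y : 'I_T -> 'rV[R]_m)
    (v_init : v 0%N = dgf_center Z omega)
    (z_step : forall t : 'I_T,
       z t = prox Z omega domega (v t) ((gamma t * theta t) *: F t (v t)))
    (z_split : forall t, z t = row_mx (x t) (y t))
    (v_step : forall t : 'I_T,
       v t.+1 = prox Z omega domega (v t) ((gamma t * theta t) *: F t (z t))) :
  (ereal_sup [set (\sum_(t < T) theta t * phi t (x t) y')%:E | y' in Y]
   - ereal_inf [set (\sum_(t < T) theta t * phi t x' (y t))%:E | x' in X]
   <= (set_width Z omega domega * L * sup (range theta))%:E)%E.
Proof.
have Zcompact : compact Z by rewrite defZ; exact: prod_set_compact.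
have Zconvex : convex_set Z by rewrite defZ; exact: prod_set_convex.
set S := sup (range theta); have S0 : 0 < S := simplex_sup_gt0 theta_simplex.
have LS0 : 0 < L * S by rewrite mulr_gt0.
have vZo k : (k <= T)%N -> dgf_domain Z omega (v k).
  elim: k => [|k IH] kT.
    by rewrite v_init; exact: dgf_center_domain setup.
  rewrite (v_step (Ordinal kT)); apply: (prox_in_domain setup).
  exact: IH (ltnW kT).
have zZ t : Z (z t).
  by rewrite z_step; apply: (prox_in_domain setup _ (vZo _ _)).1; exact: ltnW.
have XYz t : X (x t) /\ Y (y t).
  by have := zZ t; rewrite defZ /prod_set/= z_split row_mxKl row_mxKr.
have step u t : Z u -> theta t * dotp (F t (z t)) (z t - u) <=
    L * S * (bregman omega domega (v t) u - bregman omega domega (v t.+1) u).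
  move=> Zu; have vt := vZo t (ltnW (ltn_ord t)).
  have a0 : 0 <= gamma t * theta t.
    by rewrite defgamma mulr_ge0 ?divr_ge0 ?(ltW LS0) ?theta_simplex.1.
  (* The step size makes the scaled field nonexpansive for every t. *)
  have aL : gamma t * theta t * L <= 1.
    rewrite defgamma -/S (_ : _ * L = theta t / S); last first.
      by field; rewrite !gt_eqF.
    by rewrite ler_pdivrMr// mul1r; exact: simplex_le_sup.
  have lip w : dotp ((gamma t * theta t) *: F t (z t) -
      (gamma t * theta t) *: F t (v t)) w <= N (z t - v t) * N w.
    rewrite -scalerBr dotpZl.
    have Nw := is_norm_ge0 (setup_norm setup) w.
    have Nzv := is_norm_ge0 (setup_norm setup) (z t - v t).
    have := dotp_le_dual (setup_norm setup) (F t (z t) - F t (v t)) w.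
    have := ler_wpM2r Nw (F_lipschitz t _ _ (zZ t) vt.1).
    move=> /[swap] /le_trans/[apply] /(ler_wpM2l a0)/le_trans; apply.
    set a := gamma t * theta t in aL *.
    rewrite (_ : a * _ = a * L * (N (z t - v t) * N w)); last by ring.
    by rewrite ler_piMl// mulr_ge0.
  have := extragradient_step setup Zcompact Zconvex vt Zu
    (z_step t) (v_step t) lip.
  by rewrite dotpZl -mulrA defgamma div1r ler_pdivrMl.
apply: ereal_sup_sub_inf_le => // y' x' Yy' Xx'.
have Zu : Z (row_mx x' y') by rewrite defZ /prod_set/= row_mxKl row_mxKr.
set u := row_mx x' y' in Zu.
pose b k := bregman omega domega (v k) u.
apply: (@le_trans _ _ (\sum_(t < T) L * S * (b t - b t.+1))).
  rewrite -sumrB ler_sum// => t _; apply: le_trans (step u t Zu).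
  rewrite -mulrBr ler_wpM2l ?theta_simplex.1// defF z_split.
  have [Xx Yy] := XYz t.
  exact: gap_le_saddle_field Xx' Yy' (gradxP t _ _ Xx Yy) (gradyP t _ _ Xx Yy).
rewrite -mulr_sumr -(big_mkord xpredT (fun t => b t - b t.+1)).
under eq_bigr do rewrite -opprB.
rewrite sumrN telescope_sumr// opprB mulrC -mulrA ler_wpM2r ?(ltW LS0)//.
have bT := bregman_ge0 setup (vZo T (leqnn _)) Zu.
have b0 := bregman_le_width setup Zu.
by rewrite /b v_init; lra.
Qed.
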